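(* Let $k,t,j,w$ be fixed integers with $1\le j<t<k$ and $1\le w<k-t$. Put $\alpha=\gamma(w,t,j)-\gamma(k-t,t,j)$ and $\beta=\gamma(w-1,t+1,j)-\gamma(w,t,j)$. Then there is a function $\varepsilon(n)$ with $\varepsilon(n)\to0$ as $n\to\infty$ such that for all sufficiently large $n$ the following holds: if $\mathcal F\subset\binom{[n]}{k}$ is $t$-intersecting and $$|\mathcal F|>\frac{\alpha+\beta+\varepsilon(n)}{\beta}\binom{2k-t}{w+1}\binom{n-2k+t}{k-w-t-1},$$ then $$|\partial^j\mathcal F|\ge\gamma(w,t,j)\,|\mathcal F|.$$
   Context: $[n]=\{1,\dots,n\}$, and $\binom{[n]}{k}$ is the collection of all $k$-element subsets of $[n]$. A family $\mathcal F\subset\binom{[n]}{k}$ is $t$-intersecting if $|F\cap F'|\ge t$ for all $F,F'\in\mathcal F$. The $j$'th shadow is $\partial^j\mathcal F=\{G\in\binom{[n]}{k-j} : \exists F\in\mathcal F,\ G\subset F\}$. For integers $\ell\ge0$, $t\ge j\ge 1$, $$\gamma(\ell,t,j)=\binom{t+2\ell}{t+\ell-j}\Big/\binom{t+2\ell}{t+\ell}.$$ *)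

(* Defs.v *)
From HB Require Import structures.
From mathcomp Require Import all_boot all_order all_algebra.
From mathcomp Require Import all_classical all_reals all_analysis.

Set Implicit Arguments.
Unset Strict Implicit.
Unset Printing Implicit Defensive.

Import Order.TTheory GRing.Theory Num.Theory.
Import numFieldNormedType.Exports.

Local Open Scope ring_scope.

(* The ground set [n] = {1, ..., n} is represented by 'I_n = {0, ..., n - 1}. *)

Definition k_uniform (n k : nat) (F : {set {set 'I_n}}) : Prop :=
  forall A : {set 'I_n}, A \in F -> #|A| = k.

(* The case A = B is included, as in the usual definition. *)
Definition t_intersecting (n t : nat) (F : {set {set 'I_n}}) : Prop :=
  forall A B : {set 'I_n}, A \in F -> B \in F -> (t <= #|A :&: B|)%N.

Definition shadow (n k j : nat) (F : {set {set 'I_n}}) : {set {set 'I_n}} :=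
  [set G : {set 'I_n} | (#|G| == k - j)%N && [exists A in F, G \subset A]].

(* Meant for 1 <= j <= t, where the natural-number subtraction is exact. *)
Definition gamma (R : realType) (l t j : nat) : R :=
  'C(t + 2 * l, t + l - j)%:R / 'C(t + 2 * l, t + l)%:R.

(* Main.v *)
(* Left shifting keeps |F| and the intersection property and does not increase
   the shadow, so F may be assumed shifted.  Then any A, B in F admit an m with
   |A /\ [m]| + |B /\ [m]| >= m + t.  For A = B this gives Frankl's condition:
   |A /\ [t + 2 l]| >= t + l for some l <= k - t.

   If every member of a family satisfies |A /\ [s + 2 l]| >= s + l for some
   l <= L, delete j elements only inside [s + 2 l], for the largest such l: l can
   be read off from the result, so a local LYM count gives a shadow of size at
   least gamma(L, s, j) times the family.

   Let F1 be the members of F meeting [2 k - t] in at most t + w points, and F0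
   the others.  If every member of F1 satisfies the condition for s = t + 1 and
   L = w - 1, then F1 gains beta per member over gamma(w, t, j), while F0 loses
   at most alpha per member.  The count with j = t (where gamma = 1) bounds |F0|
   by the number of (k - t)-sets meeting [2 k - t] in more than w points, which
   is (1 + O(1/n)) C(2k-t, w+1) C(n-2k+t, k-w-t-1), and the gain wins.  If some
   A in F1 violates the condition, comparing A with any B in F shows that all of
   F satisfies the condition for s = t and L = w, which is enough. *)

Require Import Defs.
From HB Require Import structures.
From mathcomp Require Import all_boot all_order all_algebra.
From mathcomp Require Import all_classical all_reals all_analysis.
From mathcomp Require Import zify lra.
From mathcomp Require Import fintype finset perm.

Set Implicit Arguments.
Unset Strict Implicit.
Unset Printing Implicit Defensive.

Import Order.TTheory GRing.Theory Num.Theory.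
Import numFieldNormedType.Exports.

(** * Shifting *)

Section Shift.

Variables (n : nat) (x y : 'I_n).

Definition swap_set (A : {set 'I_n}) : {set 'I_n} := [set z | tperm x y z \in A].

(** The operation replacing [x] by [y], tested on the pair [A], [swap_set A]: two members both stay,
    and a single one becomes the set with [y] and without [x]. No image of a map is involved, hence
    no injectivity proof. *)
Definition shift_family (F : {set {set 'I_n}}) : {set {set 'I_n}} :=
  [set A | ((A \in F) && (swap_set A \in F)) ||
           (((x \notin A) || (y \in A)) && ((A \in F) || (swap_set A \in F)))].

Lemma swap_setK : involutive swap_set.
Proof. by move=> A; apply/setP=> z; rewrite !inE tpermK. Qed.

Lemma swap_set_imset A : swap_set A = tperm x y @: A.
Proof.
apply/setP=> z; rewrite inE; apply/idP/imsetP=> [h|[u uA ->]].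
  by exists (tperm x y z); rewrite // tpermK.
by rewrite tpermK.
Qed.

Lemma card_swap_set A : #|swap_set A| = #|A|.
Proof. by rewrite swap_set_imset card_imset //; apply: perm_inj. Qed.

Lemma swap_setI (A B : {set 'I_n}) : swap_set (A :&: B) = swap_set A :&: swap_set B.
Proof. by apply/setP=> z; rewrite !inE. Qed.

Lemma swap_setS (A B : {set 'I_n}) : A \subset B -> swap_set A \subset swap_set B.
Proof. by rewrite !swap_set_imset; apply: imsetS. Qed.

Lemma mem_swapL A : (x \in swap_set A) = (y \in A).
Proof. by rewrite inE tpermL. Qed.

Lemma mem_swapR A : (y \in swap_set A) = (x \in A).
Proof. by rewrite inE tpermR. Qed.

Lemma swap_set_id (A : {set 'I_n}) : (x \in A) = (y \in A) -> swap_set A = A.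
Proof. by move=> h; apply/setP=> z; rewrite inE; case: tpermP => [->|->|]. Qed.

Lemma shiftP F (A : {set 'I_n}) : A \in shift_family F ->
  [\/ A \in F /\ swap_set A \in F, [/\ A \in F, x \notin A & y \in A] |
      [/\ swap_set A \in F, x \notin A & y \in A]].
Proof.
rewrite inE => /orP[/andP[]|]; first by constructor 1.
have [/eqP/swap_set_id->|] := boolP ((x \in A) == (y \in A)).
  by rewrite orbb => /andP[_ ?]; constructor 1.
case: (x \in A); case: (y \in A) => //= _ /orP[]; first by constructor 2.
by constructor 3.
Qed.

Lemma shift_uniform k F : k_uniform k F -> k_uniform k (shift_family F).
Proof.
move=> uF A /shiftP[[/uF]|[/uF]|[/uF]] //.
by rewrite card_swap_set.
Qed.

Lemma shift_intersecting t F : t_intersecting t F -> t_intersecting t (shift_family F).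
Proof.
move=> iF.
(* The one case where only one of the sets has moved: [A] stayed and [B] came from [swap_set B].
   Since [A] misses [x] and both contain [y], [A :&: swap_set B] lies in [A :&: B]. *)
have mixed (A B : {set 'I_n}) : x \notin A -> y \in A -> x \notin B -> y \in B ->
    A \in F -> swap_set B \in F -> t <= #|A :&: B|.
  move=> xA yA xB yB AF BF; apply: leq_trans (iF _ _ AF BF) _.
  apply/subset_leq_card/subsetP=> z; rewrite !inE => /andP[zA].
  move: zA; case: tpermP => [->|->|_ _ -> -> //].
    by rewrite (negbTE xA).
  by rewrite yA yB.
have both (A B : {set 'I_n}) : swap_set A \in F -> swap_set B \in F -> t <= #|A :&: B|.
  by move=> AF BF; rewrite -card_swap_set swap_setI iF.
move=> A B /shiftP[[A1 A2]|[A1 A2 A3]|[A1 A2 A3]]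
           /shiftP[[B1 B2]|[B1 B2 B3]|[B1 B2 B3]]; auto.
by rewrite setIC; auto.
Qed.

(** Within a pair the shift only redistributes membership. Summing over all sets, which counts every
    pair twice, yields [card_shift] without a bijection. *)
Lemma shift_indicator F (A : {set 'I_n}) :
  (A \in shift_family F) + (swap_set A \in shift_family F) =
  (A \in F) + (swap_set A \in F).
Proof.
have [/eqP h|] := boolP ((x \in A) == (y \in A)).
  have E := swap_set_id h; rewrite E !inE E h.
  by case: (A \in F); case: (y \in A).
rewrite !inE swap_setK !tpermL !tpermR.
by case: (x \in A); case: (y \in A); case: (A \in F); case: (swap_set A \in F).
Qed.

Lemma sum_swap_set (f : {set 'I_n} -> nat) :
  2 * \sum_A f A = \sum_A (f A + f (swap_set A)).
Proof.
rewrite big_split /= mul2n -addnn; congr (_ + _).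
by rewrite (reindex_inj (can_inj swap_setK)).
Qed.

Lemma sum_mem_indicator (F : {set {set 'I_n}}) (f : {set 'I_n} -> nat) :
  \sum_(A in F) f A = \sum_A (A \in F) * f A.
Proof.
by rewrite big_mkcond; apply: eq_bigr => A _; case: (A \in F); rewrite ?mul1n.
Qed.

Lemma card_shift F : #|shift_family F| = #|F|.
Proof.
apply/eqP; rewrite -(eqn_pmul2l (m := 2)) // -!sum1_card !sum_mem_indicator !sum_swap_set.
by apply/eqP/eq_bigr=> A _; rewrite !muln1 shift_indicator.
Qed.

(** The shadow of the shifted family lies inside the shift of the shadow, which has as many members
    as the shadow. *)
Lemma shadow_shift k j F : #|shadow k j (shift_family F)| <= #|shadow k j F|.
Proof.
rewrite -[leqRHS]card_shift; apply/subset_leq_card/subsetP=> G.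
rewrite inE => /andP[cG /exists_inP[A AF sGA]].
have dF (C B : {set 'I_n}) :
    C \in F -> B \subset C -> #|B| == k - j -> B \in shadow k j F.
  by move=> CF sBC cB; rewrite inE cB; apply/exists_inP; exists C.
have sGA' := swap_setS sGA.
have cG' : #|swap_set G| == k - j by rewrite card_swap_set.
rewrite inE; case/shiftP: AF => [[A1 A2]|[A1 A2 A3]|[A1 A2 A3]].
- by rewrite (dF A G) // (dF (swap_set A) (swap_set G)).
- have -> : x \notin G by apply: contraNN A2 => /(subsetP sGA).
  by rewrite (dF A G) //= orbT.
have -> : x \notin G by apply: contraNN A2 => /(subsetP sGA).
by rewrite (dF (swap_set A) (swap_set G)) // !orbT.
Qed.

(** The potential that makes repeated shifting terminate: a shift with [y < x] that moves some
    member lowers its total over the family. *)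
Definition set_weight (A : {set 'I_n}) : nat := \sum_(i in A) i.

Lemma weight_swap (A : {set 'I_n}) : y < x -> x \in A -> y \notin A ->
  set_weight (swap_set A) < set_weight A.
Proof.
move=> ltyx xA yA; rewrite /set_weight [ltnRHS](bigD1 x) //=.
rewrite [ltnLHS](bigD1 y) /=; last first.
  by rewrite mem_swapR.
rewrite -addSn leq_add //; apply/eq_leq/eq_bigl => z; rewrite inE.
case: tpermP => [->|->|/eqP zx /eqP zy]; last by rewrite zx zy.
  by rewrite (negbTE yA) eqxx andbF.
by rewrite (negbTE yA) eqxx andbF.
Qed.

Lemma weight_shift (F : {set {set 'I_n}}) (A : {set 'I_n}) :
    y < x -> A \in F -> x \in A -> y \notin A ->
    swap_set A \notin F ->
  \sum_(B in shift_family F) set_weight B < \sum_(B in F) set_weight B.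
Proof.
move=> ltyx AF xA yA sAF; rewrite -(ltn_pmul2l (m := 2)) //.
rewrite !sum_mem_indicator !sum_swap_set.
have main (B : {set 'I_n}) :
    (B \in shift_family F) * set_weight B +
    (swap_set B \in shift_family F) * set_weight (swap_set B) <=
    (B \in F) * set_weight B + (swap_set B \in F) * set_weight (swap_set B).
  have [/eqP h|] := boolP ((x \in B) == (y \in B)).
    have E := swap_set_id h; rewrite E !inE E h.
    by case: (B \in F); case: (y \in B).
  rewrite !inE swap_setK !tpermL !tpermR.
  have := @weight_swap B ltyx; have := @weight_swap (swap_set B) ltyx.
  rewrite mem_swapL mem_swapR swap_setK.
  case: (x \in B); case: (y \in B); case: (B \in F); case: (swap_set B \in F) => //=; lia.
rewrite (bigD1 A) // [ltnRHS](bigD1 A) //= -addSn.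
apply: leq_add; last by apply: leq_sum => B _; apply: main.
rewrite !inE swap_setK !tpermL !tpermR AF xA (negbTE sAF) (negbTE yA) /=.
by have := weight_swap ltyx xA yA; lia.
Qed.

End Shift.

Definition shifted n (F : {set {set 'I_n}}) : Prop :=
  forall (A : {set 'I_n}) (x y : 'I_n),
    A \in F -> y < x -> x \in A -> y \notin A -> swap_set x y A \in F.

Lemma exists_shifted n k t j (F : {set {set 'I_n}}) :
    k_uniform k F -> t_intersecting t F ->
  exists F' : {set {set 'I_n}},
    [/\ shifted F', k_uniform k F', t_intersecting t F', #|F'| = #|F| &
        #|shadow k j F'| <= #|shadow k j F|].
Proof.
have [m] := ubnP (\sum_(B in F) set_weight B); elim: m F => // m IH F ltFm uF iF.
have [/forallP sF|] := boolP [forall A : {set 'I_n}, forall x : 'I_n, forall y : 'I_n,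
    [&& A \in F, y < x, x \in A & y \notin A] ==> (swap_set x y A \in F)].
  exists F; split=> // A x y AF ltyx xA yA.
  by have /forallP/(_ x)/forallP/(_ y) := sF A; rewrite AF ltyx xA yA.
case/forallPn=> A /forallPn[x /forallPn[y]].
rewrite negb_imply => /andP[/and4P[AF ltyx xA yA] sAF].
have [] := IH (shift_family x y F).
- by apply: leq_trans (weight_shift ltyx AF xA yA sAF) _.
- exact: shift_uniform.
- exact: shift_intersecting.
move=> F' [sF' uF' iF' cF' dF']; exists F'; split=> //.
  by rewrite cF' card_shift.
exact: leq_trans dF' (shadow_shift _ _ _ _ _).
Qed.
(** * Shadows inside prefixes *)

Definition local_shadow (T : finType) (X : {set T}) (j : nat)
    (H : {set {set T}}) : {set {set T}} :=
  [set G : {set T} | [exists F in H,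
    [&& G \subset F, #|F :\: G| == j & F :\: G \subset X]]].

Lemma local_shadowS (T : finType) (X Y : {set T}) j (H K : {set {set T}}) :
  X \subset Y -> H \subset K -> local_shadow X j H \subset local_shadow Y j K.
Proof.
move=> sXY sHK; apply/subsetP=> G; rewrite !inE.
case/exists_inP=> F FH /and3P[sGF dj sX]; apply/exists_inP; exists F.
  exact: (subsetP sHK).
by rewrite sGF dj (subset_trans sX).
Qed.

(** Serves disjointness: when [#|F :\: G| = j], the trace size of [F] on [Y] can be read off from
    [G], so members with different trace sizes share no local shadow set. *)
Lemma card_local_shadow_trace (T : finType) (X Y F G : {set T}) :
  G \subset F -> F :\: G \subset X -> X \subset Y ->
  #|G :&: Y| + #|F :\: G| = #|F :&: Y|.
Proof.
move=> sGF sX sXY; rewrite -(cardsID G (F :&: Y)).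
congr (_ + _); apply: eq_card => z; rewrite !inE.
  have := subsetP sGF z.
  by case: (z \in G); case: (z \in F); case: (z \in Y) => // /(_ isT).
have := subsetP (subset_trans sX sXY) z; rewrite !inE.
by case: (z \in G); case: (z \in F); case: (z \in Y) => // /(_ isT).
Qed.

(** Local LYM by double counting the pairs [e F G]: [F] offers at least [a] points of [X] to delete,
    while [G] keeps at least [a - j] points of [X], so at most [#|X| + j - a] points are available
    to restore. *)
Lemma card_local_shadow_ge (T : finType) (X : {set T}) (a j : nat)
    (H : {set {set T}}) :
  (forall F, F \in H -> a <= #|F :&: X|) ->
  'C(a, j) * #|H| <= 'C(#|X| + j - a, j) * #|local_shadow X j H|.
Proof.
move=> Ha.
pose e (F G : {set T}) := [&& G \subset F, #|F :\: G| == j & F :\: G \subset X].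
have degF F : F \in H -> 'C(a, j) <= #|[set G | e F G]|.
  move=> FH; apply: (leq_trans (leq_bin2l j (Ha F FH))).
  rewrite -cards_draws -(card_in_imset (f := fun J => F :\: J)); last first.
    move=> A B; rewrite !inE => /andP[sA _] /andP[sB _] eqAB.
    have sAF := subset_trans sA (subsetIl F X).
    have sBF := subset_trans sB (subsetIl F X).
    have FFK (C : {set T}) : C \subset F -> F :\: (F :\: C) = C.
      by move=> sCF; rewrite setDDr setDv set0U (setIidPr sCF).
    by rewrite -(FFK _ sAF) -(FFK _ sBF) eqAB.
  apply/subset_leq_card/subsetP=> G /imsetP[J]; rewrite !inE.
  rewrite subsetI => /andP[/andP[sJF sJX] cJ] ->.
  by rewrite /e subsetDl setDDr setDv set0U (setIidPr sJF) cJ.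
have degG G : G \in local_shadow X j H ->
    #|[set F in H | e F G]| <= 'C(#|X| + j - a, j).
  rewrite inE => /exists_inP[F0 F0H /and3P[s0 c0 sX0]].
  have cG : #|X :\: G| <= #|X| + j - a.
    have := Ha _ F0H.
    rewrite -(card_local_shadow_trace s0 sX0 (subxx X)) (eqP c0) => h.
    by rewrite cardsD setIC; lia.
  apply: leq_trans (leq_bin2l j cG).
  rewrite -cards_draws -[leqLHS](card_in_imset (f := fun F => F :\: G)); last first.
    move=> A B; rewrite !inE /e => /andP[_ /and3P[sA _ _]] /andP[_ /and3P[sB _ _]].
    move=> eqAB; rewrite -(setID A G) -(setID B G) eqAB.
    by rewrite (setIidPr sA) (setIidPr sB).
  apply/subset_leq_card/subsetP=> J /imsetP[F]; rewrite !inE /e.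
  case/andP=> _ /and3P[sF cF sFX] ->; rewrite cF andbT.
  by rewrite subsetD sFX /= disjoints_subset; apply/subsetP=> z;
    rewrite !inE => /andP[].
rewrite mulnC -sum_nat_const mulnC -sum_nat_const.
apply: (@leq_trans (\sum_(F in H) \sum_(G in local_shadow X j H) e F G)).
  apply: leq_sum => F FH; apply: leq_trans (degF F FH) _.
  rewrite -sum1_card big_mkcond [leqRHS]big_mkcond /=; apply: leq_sum => G _.
  rewrite !inE; case E: (e F G) => //.
  by have -> : [exists F in H, e F G] by apply/exists_inP; exists F.
rewrite exchange_big /=; apply: leq_sum => G GH; apply: leq_trans (degG G GH).
rewrite -sum1_card big_mkcond [leqRHS]big_mkcond /=; apply: leq_sum => F _.
by rewrite !inE; case: (F \in H); case: (e F G).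
Qed.

Definition prefix_set (n m : nat) : {set 'I_n} := [set i : 'I_n | i < m].

Lemma card_prefix_set n m : m <= n -> #|prefix_set n m| = m.
Proof.
move=> lemn; rewrite -[RHS]card_ord -(card_imset _ (f := widen_ord lemn)); last first.
  by move=> a b /(congr1 val) /= /val_inj.
apply: eq_card => i; rewrite inE; apply/idP/imsetP => [lim|[i' _ ->]] /=.
  by exists (Ordinal lim) => //; apply: val_inj.
exact: ltn_ord.
Qed.

Lemma prefix_setS n m p : m <= p -> prefix_set n m \subset prefix_set n p.
Proof.
by move=> le; apply/subsetP=> i; rewrite !inE => h; apply: leq_trans le.
Qed.

(** The ratio ['C(s + L, j) / 'C(L + j, j)], which equals gamma(L, s, j), does not increase with
    [L]. After cancellation the claim is (s+L+1)(L+1) <= (s+L+1-j)(L+1+j), whose sides differ by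
    j(s-j). *)
Lemma bin_ratio_decr s L j : j <= s ->
  'C(s + L.+1, j) * 'C(L + j, j) <= 'C(s + L, j) * 'C(L.+1 + j, j).
Proof.
move=> js.
have E1 : (s + L.+1 - j) * 'C(s + L.+1, j) = (s + L.+1) * 'C(s + L, j).
  by have := mul_bin_down (s + L.+1) j; rewrite addnS /=; nia.
have E2 : L.+1 * 'C(L.+1 + j, j) = (L.+1 + j) * 'C(L + j, j).
  by have := mul_bin_down (L.+1 + j) j; rewrite addSn /=; nia.
rewrite -(leq_pmul2l (m := (s + L.+1 - j) * L.+1)); last by rewrite muln_gt0; lia.
set a := 'C(s + L, j) in E1 *; set b := 'C(L + j, j) in E2 *.
have -> : (s + L.+1 - j) * L.+1 * ('C(s + L.+1, j) * b) =
  ((s + L.+1) * L.+1) * (a * b) by rewrite -mulnACA E1; nia.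
have -> : (s + L.+1 - j) * L.+1 * (a * 'C(L.+1 + j, j)) =
  ((s + L.+1 - j) * (L.+1 + j)) * (a * b).
  by rewrite [LHS]mulnACA E2; nia.
rewrite leq_mul2r; apply/orP; right; nia.
Qed.

(** Induction on [L], peeling off the members that satisfy the condition at [L.+1]. The others fall
    under the induction hypothesis with a ratio at least as large. *)
Lemma pseudo_intersecting_shadow n s L j (H : {set {set 'I_n}}) :
    j <= s -> s + 2 * L <= n ->
    (forall F, F \in H ->
      exists2 l, l <= L & s + l <= #|F :&: prefix_set n (s + 2 * l)|) ->
  'C(s + L, j) * #|H| <=
  'C(L + j, j) * #|local_shadow (prefix_set n (s + 2 * L)) j H|.
Proof.
move=> js; elim: L H => [|L IH] H sLn Hl.
  have := @card_local_shadow_ge _ (prefix_set n (s + 2 * 0)) (s + 0) j H.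
  rewrite card_prefix_set //.
  have -> : s + 2 * 0 + j - (s + 0) = 0 + j by lia.
  apply => F /Hl[l]; rewrite leqn0 => /eqP ->; by [].
set X := prefix_set n (s + 2 * L.+1).
pose H1 := [set F in H | s + L.+1 <= #|F :&: X|].
pose H2 := H :\: H1.
have sub12 : prefix_set n (s + 2 * L) \subset X by apply: prefix_setS; lia.
have B1 : 'C(s + L.+1, j) * #|H1| <= 'C(L.+1 + j, j) * #|local_shadow X j H1|.
  have := @card_local_shadow_ge _ X (s + L.+1) j H1.
  rewrite card_prefix_set //.
  have -> : s + 2 * L.+1 + j - (s + L.+1) = L.+1 + j by lia.
  by apply => F; rewrite inE => /andP[].
have B2 : 'C(s + L, j) * #|H2| <=
    'C(L + j, j) * #|local_shadow (prefix_set n (s + 2 * L)) j H2|.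
  apply: IH; first lia.
  move=> F; rewrite !inE => /andP[nH1 FH]; have [l lL hl] := Hl F FH.
  exists l => //; move: lL; rewrite leq_eqVlt => /orP[/eqP El|//].
  by move: hl nH1; rewrite FH El /X => ->.
set D2 := local_shadow _ j H2 in B2.
(* A common [G] would give its two parents the same trace size on [X], but that size is at least
   [s + L.+1] exactly for the members of [H1]. *)
have disj : [disjoint local_shadow X j H1 & D2].
  apply/pred0P=> G /=; apply/negP=> /andP[]; rewrite !inE.
  case/exists_inP=> F1 F1H /and3P[s1 c1 X1].
  case/exists_inP=> F2 F2H /and3P[s2 c2 X2].
  have := card_local_shadow_trace s1 X1 (subxx X).
  have := card_local_shadow_trace s2 X2 sub12.
  rewrite (eqP c1) (eqP c2) => -> E.
  by move: F1H F2H; rewrite !inE -E => /andP[_ ->] /andP[]; case: (F2 \in H).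
have subU : local_shadow X j H1 :|: D2 \subset local_shadow X j H.
  rewrite subUset !local_shadowS ?subsetDl //.
  by apply/subsetP=> F; rewrite inE => /andP[].
have cU := subset_leq_card subU.
rewrite cardsU (disjoint_setI0 disj) cards0 subn0 in cU.
apply: leq_trans (leq_mul (leqnn _) cU); rewrite mulnDr.
have -> : #|H| = #|H1| + #|H2|.
  rewrite /H2 cardsD (setIidPr _) ?subnKC //.
    by apply/subset_leq_card/subsetP=> F; rewrite inE => /andP[].
  by apply/subsetP=> F; rewrite inE => /andP[].
rewrite mulnDr leq_add //.
have c0 : 0 < 'C(L + j, j) by rewrite bin_gt0 leq_addl.
rewrite -(leq_pmul2l c0).
have := bin_ratio_decr L js; nia.
Qed.

(** * Prefix traces of shifted intersecting families *)

Lemma card_prefix_trace n m (A : {set 'I_n}) :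
  #|A :&: prefix_set n m| <= m.
Proof.
have [le|lt] := leqP m n.
  by rewrite -[leqRHS](card_prefix_set le) subset_leq_card ?subsetIr.
apply: leq_trans (ltnW lt); rewrite -[leqRHS]card_ord; exact: max_card.
Qed.

Lemma card_swap_prefix n (x y : 'I_n) (A : {set 'I_n}) m :
    y < x -> x \in A -> y \notin A ->
  #|swap_set x y A :&: prefix_set n m| = #|A :&: prefix_set n m| + (y < m <= x).
Proof.
move=> ltyx xA yA.
have Esw : swap_set x y A = y |: (A :\ x).
  apply/setP=> z; rewrite !inE; case: tpermP => [->|->|/eqP zx /eqP zy].
  - by rewrite (negbTE yA) eqxx orbF; apply/esym/eqP => E; rewrite E ltnn in ltyx.
  - by rewrite xA eqxx.
  by rewrite (negbTE zy) zx.
have -> : #|swap_set x y A :&: prefix_set n m| =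
    (y < m) + #|(A :\ x) :&: prefix_set n m|.
  rewrite Esw setIUl cardsU.
  have -> : [set y] :&: prefix_set n m :&: ((A :\ x) :&: prefix_set n m) = set0.
    apply/setP=> z; rewrite !inE; case: eqP => // ->.
    by rewrite (negbTE yA) andbF andbF.
  rewrite cards0 subn0; congr (_ + _).
  case: (ltnP y m) => h; last first.
    apply: eq_card0 => z; rewrite !inE; case: eqP => // ->.
    by rewrite ltnNge h.
  by rewrite (setIidPl _) ?cards1 // sub1set inE.
rewrite [in RHS](cardsD1 x) !inE xA /=.
have -> : (A :&: prefix_set n m) :\ x = (A :\ x) :&: prefix_set n m.
  by apply/setP=> z; rewrite !inE andbA.
move: #|_| => c; case: (ltnP y m) => ?; case: (leqP m x) => ? /=; lia.
Qed.

(** [x] is the [t]-th smallest element of [I]: ordinals start at 0, so [prefix_set n x] holds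
    exactly the points below [x]. *)
Lemma nth_element_prefix n (I : {set 'I_n}) t : 0 < t <= #|I| ->
  exists2 x, x \in I & #|I :&: prefix_set n x| = t.-1.
Proof.
move=> /andP[t0 tI].
have ex : exists m, t <= #|I :&: prefix_set n m|.
  exists n; rewrite (setIidPl _) //; apply/subsetP=> z _; by rewrite inE.
case: (ex_minnP ex) => m; case: m => [|m] tm mmin.
  have E : prefix_set n 0 = set0 by apply/setP=> z; rewrite !inE.
  by move: tm; rewrite E setI0 cards0 leqNgt t0.
have lt : #|I :&: prefix_set n m| < t.
  by rewrite ltnNge; apply/negP=> /mmin; rewrite ltnn.
have [/existsP[x /andP[xI /eqP xm]]|] := boolP [exists x, (x \in I) && (x == m :> nat)].
  exists x => //; rewrite xm; apply/eqP; rewrite eqn_leq -ltnS prednK // lt /=.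
  rewrite -ltnS prednK //; apply: leq_trans tm _.
  have -> : I :&: prefix_set n m.+1 = x |: (I :&: prefix_set n m).
    apply/setP=> z; rewrite !inE ltnS leq_eqVlt -xm -val_eqE /=.
    by case: eqVneq => //= /val_inj ->; rewrite xI.
  by rewrite cardsU1; case: (_ \notin _); rewrite ?add1n ?add0n // ltnW.
rewrite negb_exists => /forallP h; move: tm; rewrite leqNgt.
have -> : I :&: prefix_set n m.+1 = I :&: prefix_set n m; last by rewrite lt.
apply/setP=> z; rewrite !inE ltnS leq_eqVlt.
by have := h z; case: (z \in I) => //= /negbTE ->.
Qed.

(* Replace the t-th common element x of A and B, in A, by some y < x outside
   A :|: B: the prefix inequalities survive and the intersection drops. *)
Lemma shifted_intersecting_prefix n t (F : {set {set 'I_n}}) A B :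
    0 < t -> shifted F -> t_intersecting t F -> A \in F -> B \in F ->
  exists m, m + t <= #|A :&: prefix_set n m| + #|B :&: prefix_set n m|.
Proof.
move=> t0 sF iF AF BF.
have [//|N] := boolP [exists m : 'I_n.+1,
  m + t <= #|A :&: prefix_set n m| + #|B :&: prefix_set n m|].
  by move/existsP=> [m hm]; exists m.
have {}N m : m <= n -> #|A :&: prefix_set n m| + #|B :&: prefix_set n m| < m + t.
  move=> le; have := N; rewrite negb_exists => /forallP/(_ (Ordinal (le : m < n.+1))).
  by rewrite -ltnNge.
exfalso; have [c] := ubnP #|A :&: B|; elim: c A AF N => // c IH A AF N ltc.
have /nth_element_prefix[] : 0 < t <= #|A :&: B| by rewrite t0 iF.
move=> x; rewrite inE => /andP[xA xB] cx.
have cIU m : #|A :&: prefix_set n m| + #|B :&: prefix_set n m| =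
    #|(A :|: B) :&: prefix_set n m| + #|A :&: B :&: prefix_set n m|.
  by rewrite -cardsUI -setIUl setIACA setIid.
(* Otherwise [A :|: B] fills the prefix of length [x.+1], where [A :&: B] has [t] points, so [N]
   fails at [x.+1]. *)
have [y ltyx yU] : exists2 y : 'I_n, y < x & y \notin A :|: B.
  have [/existsP[y /andP[]]|] := boolP [exists y : 'I_n, (y < x) && (y \notin A :|: B)].
    by exists y.
  rewrite negb_exists => /forallP h.
  have := N _ (ltn_ord x); rewrite cIU.
  have /setIidPr -> : prefix_set n x.+1 \subset A :|: B.
    apply/subsetP=> z; rewrite inE ltnS leq_eqVlt => /orP[/eqP/val_inj->|zx].
      by rewrite inE xA.
    by have := h z; rewrite zx /= negbK.
  rewrite card_prefix_set // ltn_add2l ltnNge => /negP[].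
  rewrite (cardsD1 x) !inE xA xB ltnSn /= -[leqLHS]prednK // add1n ltnS -cx.
  apply/subset_leq_card/subsetP=> z; rewrite !inE => /andP[-> zx] /=.
  by rewrite ltnS (ltnW zx) andbT -val_eqE neq_ltn zx.
move: yU; rewrite inE negb_or => /andP[yA yB].
apply: (IH (swap_set x y A)).
- exact: sF.
- move=> m le; rewrite card_swap_prefix // addnAC.
  have [/andP[ym mx]|_] := boolP (y < m <= x); last by rewrite addn0 N.
  rewrite addn1 cIU -addSn -ltnS.
  (* When the trace of [A] gains a point, the union misses [y] and the intersection has not reached
     [x], so the old sum was at most m + t - 2: there is room for one more. *)
  have cU : #|(A :|: B) :&: prefix_set n m| < m.
    rewrite -[ltnRHS](card_prefix_set le); apply: proper_card.
    apply/properP; split; first exact: subsetIr.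
    by exists y; rewrite !inE ?(negbTE yA) ?(negbTE yB).
  have cI : #|A :&: B :&: prefix_set n m| <= t.-1.
    by rewrite -cx subset_leq_card // setIS // prefix_setS.
  by lia.
apply: leq_trans (ltc : _ <= c); apply: proper_card; apply/properP; split.
  apply/subsetP=> z; rewrite !inE => /andP[+ zB]; rewrite zB.
  by case: tpermP => [_|zy|_ _ ->//]; [rewrite (negbTE yA)|rewrite zy (negbTE yB) in zB].
by exists x; rewrite !inE ?xA // tpermL (negbTE yA).
Qed.

Lemma prefix_trace_mono n m p (A : {set 'I_n}) : m <= p ->
  #|A :&: prefix_set n m| <= #|A :&: prefix_set n p|.
Proof. by move=> le; rewrite subset_leq_card // setIS // prefix_setS. Qed.

Lemma prefix_trace_succ n m (A : {set 'I_n}) :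
  #|A :&: prefix_set n m.+1| <= #|A :&: prefix_set n m|.+1.
Proof.
rewrite -[leqLHS](cardsID (prefix_set n m)) -[leqRHS]addn1; apply: leq_add.
  by apply/subset_leq_card/subsetP=> z; rewrite !inE => /andP[/andP[-> _] ->].
apply/card_le1_eqP => u v; rewrite !inE => /andP[um /andP[_ um']] /andP[vm /andP[_ vm']].
by apply: val_inj => /=; move: um um' vm vm'; lia.
Qed.

Lemma prefix_trace_add n m d (A : {set 'I_n}) :
  #|A :&: prefix_set n (m + d)| <= #|A :&: prefix_set n m| + d.
Proof.
elim: d => [|d IH]; first by rewrite !addn0.
rewrite !addnS; apply: leq_trans (prefix_trace_succ _ _) _; exact: IH.
Qed.

Lemma shifted_prefix_self n k t (F : {set {set 'I_n}}) (A : {set 'I_n}) :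
    0 < t -> shifted F -> k_uniform k F -> t_intersecting t F -> A \in F ->
  exists2 l, l <= k - t & t + l <= #|A :&: prefix_set n (t + 2 * l)|.
Proof.
move=> t0 sF uF iF AF.
have [m hm] := shifted_intersecting_prefix t0 sF iF AF AF.
have am := card_prefix_trace m A.
have ak : #|A :&: prefix_set n m| <= k.
  by rewrite -(uF A AF) subset_leq_card ?subsetIl.
(* With a the trace on [m], 2a >= m + t says that [m] lies in [t + 2(a - t)], hence l = a - t. *)
exists (#|A :&: prefix_set n m| - t); first by lia.
have le : m <= t + 2 * (#|A :&: prefix_set n m| - t) by lia.
by apply: leq_trans (prefix_trace_mono A le); lia.
Qed.

(** If [B] failed for every [l <= w], the traces of [A] and [B] on each [m] would sum to less than m
    + t, against [shifted_intersecting_prefix]. The ranges of m are split at t, t + 2w and 2k -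
    t. *)
Lemma shifted_prefix_other n k t w (F : {set {set 'I_n}}) (A B : {set 'I_n}) :
    0 < t -> shifted F -> k_uniform k F -> t_intersecting t F ->
    A \in F -> B \in F ->
    #|A :&: prefix_set n (2 * k - t)| <= t + w ->
    (forall l, l < w -> #|A :&: prefix_set n (t + 1 + 2 * l)| <= t + l) ->
  exists2 l, l <= w & t + l <= #|B :&: prefix_set n (t + 2 * l)|.
Proof.
move=> t0 sF uF iF AF BF Aw Al.
have [/existsP[l hl]|/existsPn N] := boolP [exists l : 'I_w.+1,
  t + l <= #|B :&: prefix_set n (t + 2 * l)|].
  by exists l; rewrite // -ltnS.
have {}N l : l <= w -> #|B :&: prefix_set n (t + 2 * l)| < t + l.
  by move=> lw; rewrite ltnNge; exact: (N (Ordinal (lw : l < w.+1))).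
have [m hm] := shifted_intersecting_prefix t0 sF iF AF BF.
exfalso; move: hm; apply/negP; rewrite -ltnNge.
have Am := card_prefix_trace m A; have Bm := card_prefix_trace m B.
have [mt|tm] := ltnP m t; first by lia.
have [mw|wm] := leqP m (t + 2 * w).
  have Em : m = t + 2 * ((m - t)./2) + odd (m - t) by lia.
  move: Em; set i := (m - t)./2; case: (odd _) => Em.
    have iw : i < w by lia.
    (* Here [i < w] is read as [i.+1 <= w], so [N] applies at [i.+1], on the prefix one longer than
       [m]. *)
    have := N _ iw; have := Al _ iw.
    have -> : t + 1 + 2 * i = m by lia.
    have := @prefix_trace_mono n m (t + 2 * i.+1) B.
    by lia.
  have iw : i <= w by lia.
  have := N _ iw; have -> : t + 2 * i = m by lia.
  case: (posnP i) => [i0|ipos]; first by lia.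
  have iw' : i.-1 < w by lia.
  have := Al _ iw'; have := prefix_trace_succ (t + 1 + 2 * i.-1) A.
  have -> : (t + 1 + 2 * i.-1).+1 = m by lia.
  by lia.
have Ak : #|A :&: prefix_set n m| <= k.
  by rewrite -(uF A AF) subset_leq_card ?subsetIl.
have Bk : #|B :&: prefix_set n m| <= k.
  by rewrite -(uF B BF) subset_leq_card ?subsetIl.
have [mk|mk] := leqP m (2 * k - t); last by lia.
have := prefix_trace_mono A mk; have := N w (leqnn w).
have := prefix_trace_add (t + 2 * w) (m - (t + 2 * w)) B.
rewrite subnKC; last by lia.
by lia.
Qed.

(** * Splitting a shifted family by its trace *)

Lemma local_shadow_sub_shadow n k j X (F : {set {set 'I_n}}) :
  k_uniform k F -> local_shadow X j F \subset shadow k j F.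
Proof.
move=> uF; apply/subsetP=> G; rewrite !inE => /exists_inP[A AF /and3P[sGA /eqP cj _]].
apply/andP; split; last by apply/exists_inP; exists A.
have := cardsD A G; rewrite (setIidPr sGA) cj (uF A AF) => ->.
by have := subset_leq_card sGA; rewrite (uF A AF) => h; rewrite subKn.
Qed.

(** The second alternative exports only cardinalities, so that the theorem is left with arithmetic.
    [D1] and [D0] add up because the trace on [X] separates the two local shadows. *)
Lemma shifted_shadow_dichotomy n k t j w (F : {set {set 'I_n}}) :
    0 < w < k - t -> 0 < t -> j <= t -> 2 * k - t <= n ->
    shifted F -> k_uniform k F -> t_intersecting t F ->
  let X := prefix_set n (2 * k - t) in
  'C(t + w, j) * #|F| <= 'C(w + j, j) * #|shadow k j F| \/
  exists F1 F0 D1 D0 : nat,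
    [/\ #|F| = F1 + F0, D1 + D0 <= #|shadow k j F|,
        'C(t + w, j) * F1 <= 'C(w.-1 + j, j) * D1,
        'C(k, j) * F0 <= 'C(k - t + j, j) * D0 &
        F0 <= #|[set G : {set 'I_n} | (#|G| == k - t) && (w < #|G :&: X|)]|].
Proof.
move=> /andP[w0 wkt] t0 jt kn sF uF iF X.
have self A : A \in F ->
    exists2 l, l <= k - t & t + l <= #|A :&: prefix_set n (t + 2 * l)|.
  exact: shifted_prefix_self.
pose H1 := [set A in F | #|A :&: X| <= t + w].
have [|] := boolP [exists A in H1,
  [forall l : 'I_w, #|A :&: prefix_set n (t + 1 + 2 * l)| <= t + l]].
  case/exists_inP=> A; rewrite inE => /andP[AF Aw] /forallP Al; left.
  have := @pseudo_intersecting_shadow n t w j F jt.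
  move/(_ ltac:(lia)) => h; apply: leq_trans (h _) _.
    move=> B BF; apply: (shifted_prefix_other t0 sF uF iF AF BF Aw) => l lw.
    exact: (Al (Ordinal lw)).
  by rewrite leq_mul2l subset_leq_card ?orbT // local_shadow_sub_shadow.
move/exists_inPn => nA; right.
pose H0 := F :\: H1.
have sH0 : H0 \subset F by apply: subsetDl.
have sH1 : H1 \subset F by apply/subsetP=> A; rewrite inE => /andP[].
(* Stated for a general [i] since it is used twice: [i = j] bounds the shadow and [i = t] bounds
   [#|H0|] itself. *)
have B0 i : i <= t -> 'C(k, i) * #|H0| <= 'C(k - t + i, i) * #|local_shadow X i H0|.
  move=> it; have := @pseudo_intersecting_shadow n t (k - t) i H0 it.
  have -> : t + 2 * (k - t) = 2 * k - t by lia.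
  have -> : t + (k - t) = k by lia.
  by apply => // A /(subsetP sH0)/self.
have X1 : prefix_set n (t + 1 + 2 * w.-1) \subset X by apply: prefix_setS; lia.
exists #|H1|, #|H0|, #|local_shadow X j H1|, #|local_shadow X j H0|; split.
- by rewrite cardsD (setIidPr sH1) subnKC // subset_leq_card.
- have disj : [disjoint local_shadow X j H1 & local_shadow X j H0].
    apply/pred0P=> G /=; apply/negP=> /andP[]; rewrite !inE.
    case/exists_inP=> A1 A1H /and3P[s1 c1 Y1].
    case/exists_inP=> A2 A2H /and3P[s2 c2 Y2].
    have := card_local_shadow_trace s1 Y1 (subxx X).
    have := card_local_shadow_trace s2 Y2 (subxx X).
    rewrite (eqP c1) (eqP c2) => -> E.
    by move: A1H A2H; rewrite !inE -E => /andP[_ ->] /andP[]; case: (A2 \in F).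
  rewrite -cardsUI (disjoint_setI0 disj) cards0 addn0 subset_leq_card //.
  by apply: subset_trans (local_shadow_sub_shadow j X uF); rewrite subUset !local_shadowS.
- have := @pseudo_intersecting_shadow n (t + 1) w.-1 j H1.
  have -> : t + 1 + w.-1 = t + w by lia.
  move=> h; apply: leq_trans (h _ _ _) _; [by lia|by lia| |].
    move=> A /nA; rewrite negb_forall => /existsP[l]; rewrite -ltnNge => hl.
    by exists l; [have := ltn_ord l; lia | lia].
  by rewrite leq_mul2l subset_leq_card ?orbT // local_shadowS.
- exact: B0.
(* For [i = t] both binomials are ['C(k, t)] and cancel. Deleting [t] points of [X] from a member
   with more than [t + w] of them leaves more than [w]. *)
have := B0 t (leqnn t); rewrite subnK; last by lia.
rewrite leq_pmul2l ?bin_gt0; last by lia.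
move=> h; apply: leq_trans h _; apply/subset_leq_card/subsetP=> G; rewrite !inE.
case/exists_inP=> A AH /and3P[s1 c1 Y1].
have := card_local_shadow_trace s1 Y1 (subxx X).
have := cardsD A G; rewrite (setIidPr s1) (eqP c1).
move: AH; rewrite !inE => /andP[+ AF]; rewrite AF (uF A AF) -ltnNge /=.
have := subset_leq_card s1; rewrite (uF A AF) => g1 g2 g3 g4.
by apply/andP; split; lia.
Qed.

(** * Counting sets with a large trace *)

Lemma card_trace_le (T : finType) (X : {set T}) q i :
  #|[set G : {set T} | (#|G| == q) && (#|G :&: X| == i)]| <=
  'C(#|X|, i) * 'C(#|T| - #|X|, q - i).
Proof.
rewrite -[#|T|]cardsT -[#|_| - _](cardsDS (subsetT X)) -!cards_draws -cardsX.
rewrite -(card_in_imset (f := fun G => (G :&: X, G :\: X))); last first.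
  move=> A B _ _ [E1 E2].
  by rewrite -(setID A X) -(setID B X) E1 E2.
apply/subset_leq_card/subsetP=> p /imsetP[G]; rewrite inE => /andP[/eqP cq /eqP ci] ->.
by rewrite !inE subsetIr setSD ?subsetT //= ci eqxx cardsD ci cq eqxx.
Qed.

Lemma card_trace_gt (T : finType) (X : {set T}) q w :
  #|[set G : {set T} | (#|G| == q) && (w < #|G :&: X|)]| <=
  \sum_(i < q.+1 | w < i) 'C(#|X|, i) * 'C(#|T| - #|X|, q - i).
Proof.
rewrite -sum1_card (partition_big (fun G : {set T} => inord #|G :&: X| : 'I_q.+1)
  (fun i : 'I_q.+1 => w < i)) /=.
  apply: leq_sum => i wi; apply: leq_trans (card_trace_le X q i).
  rewrite sum1_card; apply/subset_leq_card/subsetP=> G; rewrite unfold_in !inE.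
  case/andP=> /andP[/eqP cG _] /eqP <-; rewrite cG eqxx /= inordK //.
  by rewrite ltnS -cG subset_leq_card ?subsetIl.
move=> G; rewrite inE => /andP[/eqP cG]; rewrite inordK //.
by rewrite ltnS -cG subset_leq_card ?subsetIl.
Qed.

Lemma bin_incr_half N a b : 2 * b <= N -> a <= b -> 'C(N, a) <= 'C(N, b).
Proof.
move=> + ab; elim: b ab => [|b IH]; first by rewrite leqn0 => /eqP ->.
rewrite leq_eqVlt => /orP[/eqP -> //|]; rewrite ltnS => ab le.
apply: leq_trans (IH ab _) _; first by lia.
by rewrite -(leq_pmul2l (m := b.+1)) // mul_bin_left leq_mul2r; apply/orP; right; lia.
Qed.

(** The term i = w + 1 is the main one. Each later term loses a factor of order n, because 'C(N,
    b-1) (N-b+1) = b 'C(N, b). The factor [n.+1] matches [harmonic n]. *)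
Lemma card_trace_gt_asymp n k t w :
    0 < w < k - t -> 8 * k <= n ->
  n.+1 * #|[set G : {set 'I_n} | (#|G| == k - t) &&
              (w < #|G :&: prefix_set n (2 * k - t)|)]| <=
  (n.+1 + 2 * k * (\sum_(i < (k - t).+1) 'C(2 * k - t, i))) *
    ('C(2 * k - t, w + 1) * 'C(n + t - 2 * k, k - w - t - 1)).
Proof.
move=> /andP[w0 wkt] kn.
have := card_trace_gt (prefix_set n (2 * k - t)) (k - t) w.
rewrite card_prefix_set ?card_ord; last by lia.
have -> : n - (2 * k - t) = n + t - 2 * k by lia.
set N := n + t - 2 * k; set b := k - w - t - 1; set Z := #|_|.
have wlt : w.+1 < (k - t).+1 by lia.
rewrite (bigD1 (Ordinal wlt)) //= addn1.
have -> : k - t - w.+1 = b by lia.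
set M := 'C(_, _) * 'C(N, b).
set S := (X in _ + X) => hZ.
have hS : n.+1 * S <= 2 * k * (\sum_(i < (k - t).+1) 'C(2 * k - t, i)) * 'C(N, b).
  rewrite big_distrr -mulnA big_distrl big_distrr /=.
  rewrite [leqRHS](bigID
    (fun i : 'I_(k - t).+1 => (w < i) && (i != Ordinal wlt))) /=.
  apply: leq_trans (leq_addr _ _); apply: leq_sum => i /andP[wi iw].
  have {}iw : w.+1 < i by rewrite ltn_neqAle wi andbT eq_sym.
  have ik := ltn_ord i.
  rewrite mulnCA [leqRHS]mulnCA leq_mul2l; apply/orP; right.
  have b0 : 0 < b by lia.
  have h1 : 'C(N, k - t - i) <= 'C(N, b.-1) by apply: bin_incr_half; lia.
  have := mul_bin_left N b.-1; rewrite prednK // => h2.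
  have h3 : n.+1 <= 2 * (N - b.-1) by lia.
  apply: leq_trans (leq_mul h3 h1) _; rewrite -mulnA -h2 mulnA leq_mul2r.
  by apply/orP; right; lia.
have hM : 'C(N, b) <= M by rewrite leq_pmull // bin_gt0; lia.
rewrite mulnDl; apply: leq_trans (leq_mul (leqnn _) hZ) _.
rewrite mulnDr leq_add2l; apply: leq_trans hS _.
by rewrite leq_mul2l hM orbT.
Qed.

(** * The ratio gamma and the final estimate *)

Lemma bin_gammaE l t j : j <= t + l ->
  'C(t + 2 * l, t + l - j) * 'C(l + j, j) = 'C(t + 2 * l, t + l) * 'C(t + l, j).
Proof.
move=> jle.
have f1 : 'C(t + 2 * l, t + l - j) * ((t + l - j)`! * (l + j)`!) = (t + 2 * l)`!.
  rewrite -(@bin_fact (t + 2 * l) (t + l - j)); last by lia.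
  by do ?congr (_ * _)%N; congr factorial; lia.
have f2 : 'C(t + 2 * l, t + l) * ((t + l)`! * l`!) = (t + 2 * l)`!.
  rewrite -(@bin_fact (t + 2 * l) (t + l)); last by lia.
  by do ?congr (_ * _)%N; congr factorial; lia.
have f3 : 'C(l + j, j) * (j`! * l`!) = (l + j)`!.
  rewrite -(@bin_fact (l + j) j) ?leq_addl //.
  by do ?congr (_ * _)%N; congr factorial; lia.
have f4 := bin_fact jle.
have pos : 0 < j`! * l`! * (t + l - j)`! by rewrite !muln_gt0 !fact_gt0.
apply/eqP; rewrite -(eqn_pmul2r pos); apply/eqP.
transitivity (t + 2 * l)`!.
  by rewrite -f1 -f3; nia.
by rewrite -f2 -f4; nia.
Qed.

Local Open Scope classical_set_scope.
Local Open Scope ring_scope.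

(** Turns gamma into the ratio of degrees produced by the local LYM count. *)
Lemma gammaE (R : realType) (l t j : nat) : (j <= t + l)%N ->
  Defs.gamma R l t j = 'C(t + l, j)%:R / 'C(l + j, j)%:R.
Proof.
move=> jle; rewrite /Defs.gamma.
have c1 : 'C(t + 2 * l, t + l)%:R != 0 :> R by rewrite pnatr_eq0 -lt0n bin_gt0; lia.
have c2 : 'C(l + j, j)%:R != 0 :> R by rewrite pnatr_eq0 -lt0n bin_gt0; lia.
by apply/eqP; rewrite eqr_div // -!natrM bin_gammaE // mulnC.
Qed.

Lemma gamma_le (R : realType) (l t j a d : nat) : (j <= t + l)%N ->
  ('C(t + l, j) * a <= 'C(l + j, j) * d)%N ->
  Defs.gamma R l t j * a%:R <= d%:R.
Proof.
move=> jle h; rewrite gammaE // mulrAC ler_pdivrMr ?ltr0n ?bin_gt0 ?leq_addl //.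
by rewrite -!natrM ler_nat mulnC [leqRHS]mulnC mulnC.
Qed.

Lemma gamma_decr (R : realType) (l m t j : nat) : (j <= t)%N -> (l <= m)%N ->
  Defs.gamma R m t j <= Defs.gamma R l t j.
Proof.
move=> jt; elim: m => [|m IH]; first by rewrite leqn0 => /eqP ->.
rewrite leq_eqVlt => /orP[/eqP -> //|]; rewrite ltnS => /IH; apply: le_trans.
rewrite !gammaE; try lia.
rewrite ler_pdivrMr ?ltr0n ?bin_gt0 ?leq_addl // mulrAC.
rewrite ler_pdivlMr ?ltr0n ?bin_gt0 ?leq_addl // -!natrM ler_nat.
exact: bin_ratio_decr.
Qed.

Theorem theorem7p3 (R : realType) (k t j w : nat)
    (hj : (1 <= j)%N) (hjt : (j < t)%N) (htk : (t < k)%N)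
    (hw : (1 <= w)%N) (hwk : (w < k - t)%N) :
  let alpha : R := Defs.gamma R w t j - Defs.gamma R (k - t) t j in
  let beta : R := Defs.gamma R (w - 1) (t + 1) j - Defs.gamma R w t j in
  exists eps : nat -> R,
    eps n @[n --> \oo] --> (0 : R) /\
    exists N : nat, forall n : nat, (N <= n)%N ->
      forall F : {set {set 'I_n}},
        k_uniform k F -> t_intersecting t F ->
        (alpha + beta + eps n) / beta
          * 'C(2 * k - t, w + 1)%:R
          * 'C(n + t - 2 * k, k - w - t - 1)%:R < #|F|%:R ->
        Defs.gamma R w t j * #|F|%:R <= #|shadow k j F|%:R.
Proof.
move=> alpha beta.
have alpha_ge0 : 0 <= alpha by rewrite subr_ge0 gamma_decr //; lia.
(* Both gammas have numerator ['C(t + w, j)]; Pascal's rule makes the denominators differ strictly,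
   using [1 <= j]. *)
have beta_gt0 : 0 < beta.
  rewrite subr_gt0 !gammaE; try lia.
  have -> : (t + 1 + (w - 1) = t + w)%N by lia.
  rewrite ltr_pM2l ?ltr0n ?bin_gt0; last by lia.
  rewrite ltf_pV2 ?posrE ?ltr0n ?bin_gt0 ?leq_addl // ltr_nat.
  have -> : (w + j = (w - 1 + j).+1)%N by lia.
  case: j hj {hjt alpha beta alpha_ge0} => // j _.
  by rewrite binS -[ltnLHS]addn0 ltn_add2l bin_gt0; lia.
pose K := (2 * k * (\sum_(i < (k - t).+1) 'C(2 * k - t, i)))%N.
(* Chosen so that alpha + beta + eps(n) is at least, in fact equals, alpha + beta times 1 + K/(n+1)
   on the sum, the factor in the bound for [F0]. *)
exists (fun n => (alpha + beta) * K%:R * harmonic n); split.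
  by rewrite -(mulr0 ((alpha + beta) * K%:R)); apply: cvgMr; apply: cvg_harmonic.
exists (8 * k)%N => n kn F uF iF hF.
have [G [sG uG iG cG dG]] := exists_shifted j uF iF.
rewrite -cG in hF *.
apply: le_trans (_ : #|shadow k j G|%:R <= _); last by rewrite ler_nat.
have wk : (0 < w < k - t)%N by rewrite hw.
have [h|[F1 [F0 [D1 [D0 [cF cD h1 h0 hZ]]]]]] :=
  shifted_shadow_dichotomy wk (ltn_trans hj hjt) (ltnW hjt)
    (leq_trans (ltac:(lia) : (2 * k - t <= 8 * k)%N) kn) sG uG iG.
  by apply: gamma_le => //; lia.
move: hF; set M1 := 'C(_, _)%:R; rewrite -mulrA -natrM.
set M := (_ * _)%N => hF.
have n0 : 0 < n.+1%:R :> R by rewrite ltr0n.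
have hF0 : F0%:R <= (1 + K%:R * harmonic n) * M%:R :> R.
  have -> : 1 + K%:R * harmonic n = (n.+1 + K)%:R / n.+1%:R :> R.
    by rewrite /harmonic /= natrD mulrDl divff ?lt0r_neq0.
  rewrite mulrAC ler_pdivlMr // -!natrM ler_nat mulnC.
  exact: leq_trans (leq_mul (leqnn _) hZ) (card_trace_gt_asymp wk kn).
have g1 : Defs.gamma R (w - 1) (t + 1) j * F1%:R <= D1%:R.
  apply: gamma_le; first by lia.
  have -> : (t + 1 + (w - 1) = t + w)%N by lia.
  by rewrite subn1.
have g0 : Defs.gamma R (k - t) t j * F0%:R <= D0%:R.
  by apply: gamma_le; [lia|rewrite subnKC // ltnW].
(* Equivalent to alpha F0 <= beta F1: the surplus from [F1] covers the deficit from [F0]. *)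
have gain : (alpha + beta) * F0%:R <= beta * (F1 + F0)%:R.
  rewrite -cF; apply/ltW.
  apply/(le_lt_trans (y := (alpha + beta) * ((1 + K%:R * harmonic n) * M%:R))).
    by rewrite ler_wpM2l // addr_ge0 // ltW.
  move: hF; rewrite mulrAC ltr_pdivrMr // [_ * beta]mulrC.
  by apply: le_lt_trans; rewrite mulrA mulrDr mulr1 !mulrA.
have cD' : D1%:R + D0%:R <= #|shadow k j G|%:R :> R by rewrite -natrD ler_nat.
apply: le_trans cD'; apply: le_trans (lerD g1 g0).
rewrite cF natrD; move: gain; rewrite natrD /alpha /beta.
set a := Defs.gamma R w t j; set b := Defs.gamma R (k - t) t j.
set c := Defs.gamma R _ _ j => gain; nra.
Qed.
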